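(* There exist absolute constants $C,c>0$ such that the following holds. Let $G=\mathrm{SL}(2,q)$ and let $u,v$ be probability distributions on $G^2$. Let $a=(a_1,a_2)$ be sampled according to $u$ and, independently, $b=(b_1,b_2)$ according to $v$. Then for every $g\in G$, \[\left|\Pr_{a,b}[a_1b_1a_2b_2=g]-\frac1{|G|}\right|\le \gamma\,|G|\,\|u\|_2\|v\|_2,\qquad\text{where }\gamma=C|G|^{-c}.\]
   Context: For a function $w:H\to\mathbb R$ on a finite set $H$, $\|w\|_2=\sqrt{\sum_{x\in H}w(x)^2}$ (unnormalized $\ell_2$ norm). A distribution on $G^2$ is identified with its probability mass function. $\mathrm{SL}(2,q)$ is the group of $2\times2$ determinant-one matrices over $\mathbb F_q$. *)

(* Defs.v *)
From HB Require Import structures.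
From mathcomp Require Import all_boot all_order all_algebra all_field.
From Stdlib Require Import Reals.
Set Implicit Arguments. Unset Strict Implicit. Unset Printing Implicit Defensive.

Definition SL2 (F : finFieldType) : {set 'M[F]_2} :=
  [set A : 'M[F]_2 | (determinant A == GRing.one F)].

Definition SL2sq (F : finFieldType) : {set 'M[F]_2 * 'M[F]_2} :=
  setX (SL2 F) (SL2 F).

Definition Rsum (T : finType) (A : {set T}) (f : T -> R) : R :=
  \big[Rplus/0%R]_(x in A) f x.

Definition is_distr (F : finFieldType) (u : 'M[F]_2 * 'M[F]_2 -> R) : Prop :=
  (forall x, (0 <= u x)%R) /\
  (forall x, x \notin SL2sq F -> u x = 0%R) /\
  Rsum (SL2sq F) u = 1%R.

Definition l2norm (F : finFieldType) (u : 'M[F]_2 * 'M[F]_2 -> R) : R :=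
  sqrt (Rsum (SL2sq F) (fun x => (u x * u x)%R)).

Definition prob_word (F : finFieldType) (u v : 'M[F]_2 * 'M[F]_2 -> R)
  (g : 'M[F]_2) : R :=
  Rsum (SL2sq F) (fun a =>
    Rsum (SL2sq F) (fun b =>
      if (mulmx (mulmx (mulmx a.1 b.1) a.2) b.2 == g) then (u a * v b)%R else 0%R)).

(* Main.v *)
From HB Require Import structures.
Require Import Defs.
From mathcomp Require Import all_boot all_order all_algebra all_field all_fingroup.
From mathcomp Require Import ring lra zify.
Set Implicit Arguments. Unset Strict Implicit. Unset Printing Implicit Defensive.
Import Order.TTheory GRing.Theory Num.Theory.
Local Open Scope ring_scope.

(* Put N = |G| and let M be the 0/1 matrix on G^2 of the relation
   a1 b1 a2 b2 = g.  Then M M^T is the operator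
   (T f)(a, c) = sum_(t, x) f (a t^-1, t^x c), so that for f of sum zero
   |T f|^2 = sum_(s, t, x, y) F ((s t)^-1, s^x t^y), where F is the
   autocorrelation of f, bounded by |f|^2 and of sum zero.  Hence T is small
   on functions of sum zero as soon as, for most s and t, the product of
   random conjugates of s and t is close to uniform, and by averaging only a
   lower bound on the number of solutions of s^x t^y = z is needed.
   In SL(2, q) with tr(s)^2, tr(t)^2, tr(z)^2 all different from 4, conjugacy
   amounts to equality of traces and the solutions are counted by the points
   of nondegenerate plane conics, each having at least q - 2 points; this
   gives at least (q - 2)^3 = N (1 - O(1/q)) solutions for all but O(1) values
   of tr(z). *)

(** * Products of random conjugates and interleaved products *)

(** Lagrange's identity: the sum over all [i, j] of the squares of [f i * g j - f j * g i] is twice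
    the gap between the two sides. *)
Lemma Cauchy_Schwarz_sum (R : realFieldType) (I : finType) (f g : I -> R) :
  (\sum_i f i * g i) ^+ 2 <= (\sum_i f i ^+ 2) * (\sum_i g i ^+ 2).
Proof.
have : 0 <= \sum_i \sum_j (f i * g j - f j * g i) ^+ 2.
  by apply: sumr_ge0 => i _; apply: sumr_ge0 => j _; apply: sqr_ge0.
have -> : \sum_i \sum_j (f i * g j - f j * g i) ^+ 2 =
  (\sum_i f i ^+ 2) * (\sum_i g i ^+ 2) *+ 2 - (\sum_i f i * g i) ^+ 2 *+ 2.
  rewrite [X in _ = X - _]mulr2n {2}[(\sum_i f i ^+ 2) * _]mulrC expr2.
  rewrite !big_distrlr /= -sumrMnl -big_split -sumrB.
  apply: eq_bigr => i _; rewrite -sumrMnl -big_split -sumrB.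
  by apply: eq_bigr => j _ /=; ring.
by rewrite -mulrnBl pmulrn_lge0 // subr_ge0.
Qed.

Section Interleaving.
Variables (R : realFieldType) (gT : finGroupType).
Implicit Types (f u v : gT * gT -> R) (a b : gT * gT) (s t x y : gT).

Definition num_conj_factor s t z : nat :=
  #|[set p : gT * gT | (s ^ p.1 * t ^ p.2 == z)%g]|.

(** Subtraction in [nat] truncates, so only those [z] with fewer factorisations than the average
    [#|gT|] contribute. *)
Definition deficit s t : nat := (\sum_z (#|gT| - num_conj_factor s t z))%N.

(* M^T f, in the notation of the header; [conj_shift] below is M M^T. *)
Definition interleave (g : gT) f b : R :=
  \sum_x f (x, b.1^-1 * x^-1 * g * b.2^-1)%g.

Definition conj_shift f a : R :=
  \sum_t \sum_x f (a.1 * t^-1, t ^ x * a.2)%g.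

Definition autocorr f x y : R := \sum_a f a * f (a.1 * x, y * a.2)%g.

Lemma pair_shift f x y : \sum_a f (a.1 * x, y * a.2)%g = \sum_a f a.
Proof.
rewrite [RHS](reindex (fun a : gT * gT => (a.1 * x, y * a.2)%g)) //=.
exists (fun a : gT * gT => (a.1 * x^-1, y^-1 * a.2)%g) => -[a c] _ /=.
  by rewrite mulgK mulKg.
by rewrite mulgKV mulKVg.
Qed.

Lemma sum_pair f : \sum_a f a = \sum_x \sum_y f (x, y).
Proof. by rewrite pair_big; apply: eq_bigr => -[]. Qed.

(** Termwise |p q| <= (p^2 + q^2) / 2, and translating [a] preserves the sum of squares. *)
Lemma autocorr_le f x y : `|autocorr f x y| <= \sum_a f a ^+ 2.
Proof.
apply: le_trans (ler_norm_sum _ _ _) _.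
apply: (@le_trans _ _ (\sum_a (f a ^+ 2 + f (a.1 * x, y * a.2)%g ^+ 2) / 2)).
  apply: ler_sum => a _; rewrite ler_norml; set p := f a; set q := f _.
  have := sqr_ge0 (p + q); have := sqr_ge0 (p - q); nra.
rewrite -mulr_suml big_split /= (pair_shift (fun a => f a ^+ 2)).
by lra.
Qed.

(** For fixed [a], the translates of [a] run once over all pairs as [x] and [y] vary. *)
Lemma sum_autocorr f : \sum_x \sum_y autocorr f x y = (\sum_a f a) ^+ 2.
Proof.
rewrite pair_big /= /autocorr exchange_big /= expr2 mulr_suml.
apply: eq_bigr => -[a c] _ /=; rewrite -mulr_sumr; congr (_ * _).
rewrite [RHS](reindex (fun p : gT * gT => (a * p.1, p.2 * c)%g)) //=.
exists (fun p : gT * gT => (a^-1 * p.1, p.2 * c^-1)%g) => -[p q] _ /=.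
  by rewrite mulKg mulgK.
by rewrite mulKVg mulgKV.
Qed.

Lemma sum_num_conj_factor s t : (\sum_z num_conj_factor s t z = #|gT| ^ 2)%N.
Proof.
rewrite -mulnn -card_prod -sum1_card.
rewrite (partition_big (fun p : gT * gT => s ^ p.1 * t ^ p.2)%g xpredT) //=.
by apply: eq_bigr => z _; rewrite sum1_card /num_conj_factor cardsE.
Qed.

Lemma deficit_le s t : (deficit s t <= #|gT| ^ 2)%N.
Proof.
apply: (@leq_trans (\sum_(z : gT) #|gT|)); first by apply: leq_sum => z _; exact: leq_subr.
by rewrite sum_nat_const mulnn.
Qed.

Lemma sum_conj_factor (h : gT -> R) s t :
  \sum_x \sum_y h (s ^ x * t ^ y)%g = \sum_z (num_conj_factor s t z)%:R * h z.
Proof.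
rewrite pair_big /=.
rewrite (partition_big (fun p : gT * gT => s ^ p.1 * t ^ p.2)%g xpredT) //=.
apply: eq_bigr => z _; rewrite mulr_natl -(sumr_const (mem [set p | _])) /=.
by apply: eq_big => [p|p /eqP -> //]; rewrite inE.
Qed.

(* Since [num_conj_factor s t] has mean [#|gT|], its total deviation from the
   mean is twice the deviation from below. *)
Lemma conj_factor_equidistr (h : gT -> R) (H : R) s t :
  (forall z, `|h z| <= H) ->
  `|\sum_x \sum_y h (s ^ x * t ^ y)%g - #|gT|%:R * \sum_z h z|
    <= (deficit s t)%:R *+ 2 * H.
Proof.
move=> hH; rewrite sum_conj_factor mulr_sumr -sumrB.
apply: le_trans (ler_norm_sum _ _ _) _.
(* [d z] is the absolute deviation: twice the shortfall plus the signed deviation, and the latter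
   sums to zero. *)
pose d z := ((#|gT| - num_conj_factor s t z)%N%:R *+ 2
              + ((num_conj_factor s t z)%:R - #|gT|%:R) : R).
have -> : (deficit s t)%:R *+ 2 * H = \sum_z d z * H.
  rewrite -mulr_suml big_split /= sumrB -!natr_sum sum_num_conj_factor.
  rewrite sumrMnl -natr_sum [X in _ - X%:R]sum_nat_const mulnn subrr addr0.
  by [].
apply: ler_sum => z _; rewrite -mulrBl normrM ler_pM // /d.
case: (leqP #|gT| (num_conj_factor s t z)) => le.
  have -> : (#|gT| - num_conj_factor s t z = 0)%N by apply/eqP.
  by rewrite mul0rn add0r ger0_norm // subr_ge0 ler_nat.
rewrite natrB 1?ltnW // ltr0_norm ?subr_lt0 ?ltr_nat //; lra.
Qed.

(** |M^T f|^2 = <f, M M^T f>. The parameter [g] drops out because it is absorbed in a change of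
    variable. *)
Lemma interleave_sqr g f :
  \sum_b interleave g f b ^+ 2 = \sum_a f a * conj_shift f a.
Proof.
rewrite (sum_pair (fun b => interleave g f b ^+ 2)) /=.
rewrite (sum_pair (fun a => f a * conj_shift f a)) /=.
transitivity (\sum_(b1 : gT) \sum_(b2 : gT) \sum_x \sum_t
   f (x, b1^-1 * x^-1 * g * b2^-1)%g
   * f (x * t^-1, t ^ b1 * (b1^-1 * x^-1 * g * b2^-1))%g).
  apply: eq_bigr => b1 _; apply: eq_bigr => b2 _.
  rewrite expr2 {1}/interleave /= mulr_suml; apply: eq_bigr => x _.
  rewrite -mulr_sumr; congr (_ * _); rewrite /interleave /=.
  (* Writing the second copy of [x] as x t^-1 multiplies the second coordinate on the left by t ^
     b1. *)
  rewrite (reindex (fun t => x * t^-1)%g) /=; last first.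
    exists (fun t => t^-1 * x)%g => t _; rewrite ?invMg ?invgK ?mulgKV //.
    by rewrite mulKVg.
  by apply: eq_bigr => t _; congr (f (_, _)); rewrite /conjg !invMg invgK !mulgA mulgK.
transitivity (\sum_(b1 : gT) \sum_x \sum_c \sum_t f (x, c) * f (x * t^-1, t ^ b1 * c)%g).
  apply: eq_bigr => b1 _; rewrite exchange_big /=; apply: eq_bigr => x _.
  (* For fixed [b1] and [x], the second coordinate c replaces [b2] as summation variable, which
     removes [g]. *)
  rewrite [RHS](reindex (fun b2 : gT => b1^-1 * x^-1 * g * b2^-1)%g) //=.
  exists (fun c => c^-1 * (b1^-1 * x^-1 * g))%g => t _.
    by rewrite invMg invgK mulgKV.
  by rewrite invMg invgK mulKVg.
rewrite exchange_big; apply: eq_bigr => x _ /=.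
rewrite exchange_big; apply: eq_bigr => c _ /=.
rewrite exchange_big /conj_shift mulr_sumr /=.
by apply: eq_bigr => t _; rewrite mulr_sumr.
Qed.

(** Expand the square and translate [a] so that one of the two factors becomes [f a]. *)
Lemma conj_shift_sqr f : \sum_a conj_shift f a ^+ 2 =
  \sum_s \sum_t \sum_x \sum_y autocorr f (s * t)^-1 (s ^ x * t ^ y)%g.
Proof.
transitivity (\sum_s \sum_t \sum_x \sum_y \sum_a
   f (a.1 * t^-1, t ^ y * a.2)%g * f (a.1 * s^-1, s ^ x * a.2)%g).
  transitivity (\sum_a \sum_s \sum_t \sum_x \sum_y 
   f (a.1 * t^-1, t ^ y * a.2)%g * f (a.1 * s^-1, s ^ x * a.2)%g).
    apply: eq_bigr => a _; rewrite expr2 {1}/conj_shift mulr_suml exchange_big.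
    apply: eq_bigr => t _ /=; rewrite /conj_shift mulr_sumr.
    apply: eq_bigr => s _ /=.
    rewrite mulr_suml exchange_big; apply: eq_bigr => y _ /=.
    by rewrite mulr_sumr.
  rewrite exchange_big; apply: eq_bigr => s _ /=.
  rewrite exchange_big; apply: eq_bigr => t _ /=.
  rewrite exchange_big; apply: eq_bigr => x _ /=.
  by rewrite exchange_big.
apply: eq_bigr => s _.
(* Inverting [t] makes the relative shift a product s ^ x * t ^ y instead of a quotient. *)
rewrite (reindex_inj invg_inj) /=; apply: eq_bigr => t _.
apply: eq_bigr => x _; apply: eq_bigr => y _.
rewrite /autocorr -[RHS](pair_shift _ t (t ^ y)^-1)%g.
apply: eq_bigr => a _ /=; rewrite invgK conjVg; congr (_ * f (_, _)).
  by rewrite invMg mulgA mulgK.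
by rewrite mulgA mulgK.
Qed.

(** Replace each inner double sum by its equidistributed value. For fixed [s], (s t)^-1 runs over
    the group, so these main terms add up to a multiple of the squared sum of [f], which is zero;
    only the errors remain. *)
Lemma conj_shift_sqr_le f : \sum_a f a = 0 ->
  \sum_a conj_shift f a ^+ 2 <=
    (\sum_s \sum_t deficit s t)%N%:R *+ 2 * \sum_a f a ^+ 2.
Proof.
move=> f0; rewrite conj_shift_sqr.
have main0 : \sum_s \sum_t #|gT|%:R * \sum_z autocorr f (s * t)^-1%g z = 0.
  transitivity (\sum_(s : gT) #|gT|%:R * \sum_t \sum_z autocorr f t z).
    apply: eq_bigr => s _; rewrite -mulr_sumr; congr (_ * _).
    rewrite [RHS](reindex (fun t => (s * t)^-1)%g) //=.
    exists (fun t => s^-1 * t^-1)%g => t _; first by rewrite invgK mulKg.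
    by rewrite mulKVg invgK.
  by rewrite sum_autocorr f0 expr0n mulr0 sumr_const mul0rn.
rewrite -[leLHS]subr0 -[X in _ - X <= _]main0 -sumrB.
rewrite natr_sum -sumrMnl mulr_suml.
apply: ler_sum => s _; rewrite -sumrB natr_sum -sumrMnl mulr_suml.
apply: ler_sum => t _.
apply: le_trans (ler_norm _) _.
exact: (conj_factor_equidistr (h := autocorr f (s * t)^-1%g)) (autocorr_le _ _).
Qed.

(** The quantity |M^T f|^2 equals <f, T f>, to which Cauchy-Schwarz applies. *)
Lemma interleave_sqr_le g f : \sum_a f a = 0 ->
  (\sum_b interleave g f b ^+ 2) ^+ 2 <=
    (\sum_s \sum_t deficit s t)%N%:R *+ 2 * (\sum_a f a ^+ 2) ^+ 2.
Proof.
move=> f0; rewrite interleave_sqr.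
apply: le_trans (Cauchy_Schwarz_sum _ _) _.
rewrite mulrC expr2 mulrA; apply: ler_wpM2r (conj_shift_sqr_le f0).
by apply: sumr_ge0 => a _; apply: sqr_ge0.
Qed.

(** Once [b] and [a.1] are fixed, exactly one [a.2] solves the equation. *)
Lemma sum_interleave g u v :
  \sum_a \sum_b (if (a.1 * b.1 * a.2 * b.2 == g)%g then u a * v b else 0)
  = \sum_b interleave g u b * v b.
Proof.
rewrite exchange_big; apply: eq_bigr => b _ /=.
rewrite (sum_pair (fun a => if _ then _ else _)) /interleave mulr_suml.
apply: eq_bigr => x _; rewrite -big_mkcond /=.
rewrite (big_pred1 (b.1^-1 * x^-1 * g * b.2^-1)%g) // => y /=.
apply/eqP/eqP => [<-|->]; rewrite !mulgA ?mulgK ?mulgKV.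
  by rewrite mulVg mul1g.
by rewrite mulgV mul1g.
Qed.

(** Subtracting the uniform density [e] from [u] lowers [interleave] by exactly 1/N and does not
    increase the sum of squares. The fourth power comes from two uses of Cauchy-Schwarz: against
    [v], then in [interleave_sqr_le]. *)
Theorem interleaved_product_deviation g u v :
    \sum_a u a = 1 -> \sum_a v a = 1 ->
  (\sum_a \sum_b (if (a.1 * b.1 * a.2 * b.2 == g)%g then u a * v b else 0)
     - #|gT|%:R^-1) ^+ 4
  <= (\sum_s \sum_t deficit s t)%N%:R *+ 2
     * (\sum_a u a ^+ 2) ^+ 2 * (\sum_a v a ^+ 2) ^+ 2.
Proof.
move=> u1 v1; rewrite sum_interleave.
have Nn0 : #|gT|%:R != 0 :> R.
  by rewrite pnatr_eq0 -lt0n; apply/card_gt0P; exists 1%g.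
pose e : R := (#|gT|%:R ^+ 2)^-1; pose f a := u a - e.
have cardE : \sum_(a : gT * gT) e = 1.
  by rewrite sumr_const card_prod mulnn -mulr_natr natrX mulVf ?expf_neq0.
have f0 : \sum_a f a = 0 by rewrite sumrB u1 cardE subrr.
have fu : \sum_a f a ^+ 2 <= \sum_a u a ^+ 2.
  have -> : \sum_a f a ^+ 2 = \sum_a u a ^+ 2 - e.
    transitivity (\sum_a (u a ^+ 2 - (u a * e *+ 2 - e * e))).
      by apply: eq_bigr => a _; rewrite /f; ring.
    rewrite sumrB; congr (_ - _).
    rewrite sumrB sumrMnl -!mulr_suml u1 cardE; ring.
  by rewrite gerBl invr_ge0 exprn_ge0.
have -> : \sum_b interleave g u b * v b - #|gT|%:R^-1
          = \sum_b interleave g f b * v b.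
  have fE b : interleave g f b = interleave g u b - #|gT|%:R^-1.
    rewrite /interleave sumrB; congr (_ - _).
    by rewrite sumr_const -mulr_natr /e; field.
  under [RHS]eq_bigr => b _ do rewrite fE mulrBl.
  by rewrite sumrB -mulr_sumr v1 mulr1.
have v0 : 0 <= \sum_b v b ^+ 2 by apply: sumr_ge0 => a _; apply: sqr_ge0.
have f20 : 0 <= \sum_b f b ^+ 2 by apply: sumr_ge0 => a _; apply: sqr_ge0.
rewrite (exprM _ 2 2).
apply: (@le_trans _ _ ((\sum_b interleave g f b ^+ 2) ^+ 2 * (\sum_b v b ^+ 2) ^+ 2)).
  rewrite -exprMn; apply: lerXn2r (Cauchy_Schwarz_sum _ _).
    exact: sqr_ge0.
  by rewrite nnegrE mulr_ge0 // sumr_ge0 // => b _; apply: sqr_ge0.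
apply: ler_wpM2r; first exact: exprn_ge0.
apply: le_trans (interleave_sqr_le _ f0) _.
apply: ler_wpM2l; first by rewrite mulrn_wge0.
by rewrite lerXn2r // nnegrE // (le_trans f20).
Qed.

End Interleaving.

(** * Points on plane conics *)

Section BinaryQuadraticForms.
Variable F : finFieldType.
Implicit Types a b c e x y : F.

(** By Vieta, a root [r] leaves only -b/a - r as another; this works in every characteristic. *)
Lemma card_quadratic_roots a b c : a != 0 ->
  (#|[set x | (a * x ^+ 2 + b * x + c == 0)%R]| <= 2)%N.
Proof.
move=> a0; case: (set_0Vmem [set x | a * x ^+ 2 + b * x + c == 0]) => [->|[r]].
  by rewrite cards0.
rewrite inE => /eqP r0.
apply: (@leq_trans #|[set r; - (b / a) - r]|); last by rewrite cards2; case: (_ != _).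
apply: subset_leq_card; apply/subsetP => x; rewrite !inE => /eqP x0.
have : a * (x - r) * (x - (- (b / a) - r)) == 0.
  apply/eqP; transitivity ((a * x ^+ 2 + b * x + c) - (a * r ^+ 2 + b * r + c)).
    by field.
  by rewrite x0 r0 subrr.
by rewrite !mulf_eq0 (negPf a0) /= !subr_eq0.
Qed.

(** Zero has one square root and every other square at most two, so q <= 2 |S| - 1. *)
Lemma card_squares : (#|F| < 2 * #|[set x ^+ 2 | x in F]%R|)%N.
Proof.
set S := [set _ | _ in _].
have S0 : 0 \in S by apply/imsetP; exists 0; rewrite ?inE // expr0n.
rewrite -[ltnLHS]sum1_card (partition_big (fun x => x ^+ 2) (mem S)) /=; last first.
  by move=> x _; apply/imset_f; rewrite inE.
rewrite (bigD1 0) //=; have -> : (\sum_(x in F | (x ^+ 2 == 0)%R) 1 = 1)%N.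
  by rewrite (big_pred1 0) // => x; rewrite expf_eq0.
have -> : #|S| = #|S :\ 0|.+1 by rewrite (cardsD1 0) S0.
rewrite mulnS ltnS add1n ltnS.
rewrite mulnC -sum_nat_const.
rewrite [X in (_ <= X)%N](eq_bigl (fun s => (s \in S) && (s != 0))); last first.
  by move=> s; rewrite !inE andbC.
apply: leq_sum => s _; rewrite sum1dep_card.
have := @card_quadratic_roots 1 0 (- s) (oner_neq0 _); apply: leq_trans.
rewrite subset_leq_card //; apply/subsetP => x; rewrite !inE.
by move=> /eqP <-; rewrite mul1r mul0r addr0 subrr.
Qed.

(** If [a] is 0 the form is linear in the first variable at (x, 1); in characteristic 2 squaring is
    onto and y = 0 suffices; otherwise complete the square and use the pigeonhole principle. *)
Lemma binary_form_represents a b c e : b ^+ 2 - 4 * a * c != 0 -> e != 0 ->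
  exists p : F * F, a * p.1 ^+ 2 + b * p.1 * p.2 + c * p.2 ^+ 2 = e.
Proof.
move=> D0 e0; have [a0|a0] := eqVneq a 0.
  have b0 : b != 0 by apply: contraNneq D0 => ->; rewrite a0; apply/eqP; ring.
  by exists ((e - c) / b, 1); rewrite /= a0; field.
have [two0|two0] := eqVneq (2 : F) 0.
  have sqr_inj : injective (fun x => x ^+ 2).
    move=> x y /eqP; rewrite -subr_eq0.
    rewrite (_ : _ - _ = (x - y) ^+ 2 + 2 * (x - y) * y); last by ring.
    by rewrite two0 !mul0r addr0 expf_eq0 /= subr_eq0 => /eqP.
  have [x xE] : exists x, x ^+ 2 = e / a.
    by have [h _ hK] := injF_bij sqr_inj; exists (h (e / a)); rewrite hK.
  by exists (x, 0); rewrite /= xE; field.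
pose S := [set x ^+ 2 | x in F].
pose h s := 4 * a * e + (b ^+ 2 - 4 * a * c) * s.
have hinj : injective h by move=> s t /addrI /(mulfI D0).
(* Both sets have more than q/2 elements. A common element solves x^2 = 4 a e + D y^2, where D is
   the discriminant. *)
have : S :&: h @: S != set0.
  apply/negP => /eqP ST.
  have : (#|S :|: h @: S| < 2 * #|S|)%N := leq_ltn_trans (max_card _) card_squares.
  rewrite -[X in (X < _)%N]addn0 -[X in (_ + X < _)%N](cards0 F) -ST cardsUI (card_imset _ hinj).
  by rewrite addnn -mul2n ltnn.
case/set0Pn => s /setIP [/imsetP [x _ ->] /imsetP [_ /imsetP [y _ ->] xy]].
exists ((x - b * y) / (2 * a), y) => /=.
apply: (mulfI (_ : 4 * a != 0)); first by rewrite (_ : 4 = 2 * 2) ?mulf_neq0 //; ring.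
transitivity (x ^+ 2 - (b ^+ 2 - 4 * a * c) * y ^+ 2).
  by field; rewrite two0 a0.
by rewrite xy /h; ring.
Qed.

(* The lines through the point (1, 0) of the conic meet it in a second point. *)
Lemma card_conic_through_1 a b c : b ^+ 2 - 4 * a * c != 0 -> a != 0 ->
  (#|F| - 2 <= #|[set p : F * F | (a * p.1 ^+ 2 + b * p.1 * p.2 + c * p.2 ^+ 2 == a)%R]|)%N.
Proof.
move=> D0 a0.
pose q m := a * m ^+ 2 + b * m + c.
(* The nonzero root, in general, of s ((2 a m + b) + s q(m)) = 0, obtained by substituting (1 + s m,
   s) in the equation. *)
pose s m := - (2 * a * m + b) / q m.
pose f m : F * F := (1 + s m * m, s m).
pose Z := [set m | q m == 0].
have f_inj : {in ~: Z &, injective f}.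
  move=> m n; rewrite !inE => qm qn [].
  (* If [s m] is nonzero the point determines m. Otherwise the line is the tangent, 2 a m + b = 0,
     with a single m, or none in characteristic 2, where the discriminant forces [b] to be
     nonzero. *)
  have [s0|s0] := eqVneq (s m) 0; last first.
    by move=> e1 e2; move: e1; rewrite -e2 => /addrI /(mulfI s0).
  move=> _; rewrite s0 => /esym sn0.
  have sP k : q k != 0 -> s k = 0 -> 2 * a * k + b = 0.
    move=> qk /eqP; rewrite mulf_eq0 invr_eq0 (negPf qk) orbF oppr_eq0.
    by move/eqP.
  have [two0|two0] := eqVneq (2 : F) 0.
    have four0 : 4 = 0 :> F by transitivity (2 * 2 : F); [ring | rewrite two0 mul0r].
    case/eqP: D0; have := sP _ qn sn0; rewrite two0 !mul0r add0r => ->.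
    by rewrite four0; ring.
  apply: (mulfI (_ : 2 * a != 0)); first by rewrite mulf_neq0.
  by apply: (addIr b); rewrite !sP.
have cZ : (#|Z| <= 2)%N by apply: card_quadratic_roots.
apply: (@leq_trans #|~: Z|); first by rewrite cardsCs setCK leq_sub2l.
rewrite -(card_in_imset f_inj); apply: subset_leq_card.
apply/subsetP => _ /imsetP [m qm ->]; move: qm; rewrite !inE => qm /=.
by apply/eqP; rewrite /s /q; field.
Qed.

(** Take a vector representing [e] as first basis vector: the leading coefficient becomes [e], and
    the discriminant is multiplied by the nonzero square d^2. *)
Lemma card_conic a b c e : b ^+ 2 - 4 * a * c != 0 -> e != 0 ->
  (#|F| - 2 <= #|[set p : F * F | (a * p.1 ^+ 2 + b * p.1 * p.2 + c * p.2 ^+ 2 == e)%R]|)%N.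
Proof.
move=> D0 e0; have [[x0 y0] /= p0] := binary_form_represents D0 e0.
have [z0 [t0 d0]] : exists z t, x0 * t - y0 * z != 0.
  have [x00|x00] := eqVneq x0 0; last by exists 0, 1; rewrite mulr0 subr0 mulr1.
  exists 1, 0; rewrite mulr0 sub0r mulr1 oppr_eq0.
  by apply: contraNneq e0 => y00; rewrite -p0 x00 y00; apply/eqP; ring.
set d := _ - _ in d0.
pose b' := 2 * a * x0 * z0 + b * (x0 * t0 + y0 * z0) + 2 * c * y0 * t0.
pose c' := a * z0 ^+ 2 + b * z0 * t0 + c * t0 ^+ 2.
have D'0 : b' ^+ 2 - 4 * e * c' != 0.
  rewrite (_ : _ - _ = (b ^+ 2 - 4 * a * c) * d ^+ 2).
    by rewrite mulf_neq0 // expf_neq0.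
  by rewrite -p0 /b' /c' /d; ring.
apply: leq_trans (card_conic_through_1 D'0 e0) _.
pose f (p : F * F) := (p.1 * x0 + p.2 * z0, p.1 * y0 + p.2 * t0).
have f_inj : injective f.
  move=> [x y] [x' y'] [] /= e1 e2; congr (_, _); apply: (mulfI d0); rewrite /d.
    transitivity ((x * x0 + y * z0) * t0 - (x * y0 + y * t0) * z0); first by ring.
    by rewrite e1 e2; ring.
  transitivity ((x * y0 + y * t0) * x0 - (x * x0 + y * z0) * y0); first by ring.
  by rewrite e1 e2; ring.
rewrite -(card_imset _ f_inj); apply: subset_leq_card.
apply/subsetP => _ /imsetP [[x y] xy ->]; move: xy; rewrite !inE => /eqP /= xy.
by rewrite -[eqbRHS]xy -p0 /b' /c'; apply/eqP; ring.
Qed.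

End BinaryQuadraticForms.

(** * Counting in SL(2, q) *)

Section Matrix22.
Variable R : comNzRingType.
Implicit Types a b c d : R.

Definition mx22 a b c d : 'M[R]_2 :=
  \matrix_(i, j) if i == 0 then if j == 0 then a else b else if j == 0 then c else d.

Lemma mx22_eta (A : 'M[R]_2) : A = mx22 (A 0 0) (A 0 1) (A 1 0) (A 1 1).
Proof.
apply/matrixP => i j; rewrite mxE.
by case: i j => [[|[|//]] hi] [[|[|//]] hj] /=;
  congr (fun_of_matrix A _ _); apply: val_inj.
Qed.

Lemma mx22_inj a b c d a' b' c' d' : mx22 a b c d = mx22 a' b' c' d' ->
  [/\ a = a', b = b', c = c' & d = d'].
Proof.
by move=> /matrixP e; split; [move: (e 0 0)|move: (e 0 1)|move: (e 1 0)|move: (e 1 1)];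
  rewrite !mxE.
Qed.

Lemma mul_mx22 a b c d a' b' c' d' : mx22 a b c d *m mx22 a' b' c' d' =
  mx22 (a * a' + b * c') (a * b' + b * d') (c * a' + d * c') (c * b' + d * d').
Proof.
rewrite [LHS]mx22_eta; congr mx22; rewrite !mxE !big_ord_recl big_ord0 !mxE addr0 //.
Qed.

Lemma det_mx22 a b c d : \det (mx22 a b c d) = a * d - b * c.
Proof.
rewrite (expand_det_row _ 0) !big_ord_recl big_ord0 /cofactor !det_mx11 !mxE /=.
by rewrite expr0 expr1; ring.
Qed.

Lemma tr_mx22 a b c d : \tr (mx22 a b c d) = a + d.
Proof. by rewrite /mxtrace !big_ord_recl big_ord0 !mxE addr0. Qed.

End Matrix22.

(** * SL(2, q) as a finite group *)

Definition sl2 (F : finFieldType) := {A : 'M[F]_2 | \det A == 1}.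

Section SL2Group.
Variable F : finFieldType.
Implicit Types s t x : sl2 F.

Lemma sl2_mul_subproof s t : \det (val s *m val t) == 1.
Proof. by rewrite det_mulmx (eqP (valP s)) (eqP (valP t)) mulr1. Qed.
Lemma sl2_one_subproof : \det (1%:M : 'M[F]_2) == 1.
Proof. by rewrite det1. Qed.
Lemma sl2_inv_subproof s : \det (invmx (val s)) == 1.
Proof. by rewrite det_inv (eqP (valP s)) invr1. Qed.

Definition sl2_mul s t : sl2 F := Sub (val s *m val t) (sl2_mul_subproof s t).
Definition sl2_one : sl2 F := Sub 1%:M sl2_one_subproof.
Definition sl2_inv s : sl2 F := Sub (invmx (val s)) (sl2_inv_subproof s).

Lemma sl2_mulA : associative sl2_mul.
Proof. by move=> s t x; apply: val_inj; rewrite /= mulmxA. Qed.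
Lemma sl2_mul1 : left_id sl2_one sl2_mul.
Proof. by move=> s; apply: val_inj; rewrite /= mul1mx. Qed.
Lemma sl2_mulV : left_inverse sl2_one sl2_inv sl2_mul.
Proof.
move=> s; apply: val_inj; rewrite /= mulVmx //.
by rewrite unitmxE (eqP (valP s)) unitr1.
Qed.

HB.instance Definition _ := SubFinite.on (sl2 F).
HB.instance Definition _ := Finite_isGroup.Build (sl2 F) sl2_mulA sl2_mul1 sl2_mulV.

Lemma val_mul s t : val (s * t)%g = val s *m val t.
Proof. by []. Qed.

End SL2Group.

Section SL2Counting.
Variable F : finFieldType.
Implicit Types (s t x z : sl2 F) (a b c d r : F).

(* Defaults to the identity when the determinant is not 1. *)
Definition sl2mx a b c d : sl2 F := insubd (sl2_one F) (mx22 a b c d).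

Lemma val_sl2mx a b c d : a * d - b * c = 1 -> val (sl2mx a b c d) = mx22 a b c d.
Proof. by move=> h; rewrite insubdK // unfold_in det_mx22 h. Qed.

Lemma sl2mx_inj a b c d a' b' c' d' :
    a * d - b * c = 1 -> a' * d' - b' * c' = 1 ->
  sl2mx a b c d = sl2mx a' b' c' d' -> [/\ a = a', b = b', c = c' & d = d'].
Proof. by move=> h h' /(congr1 val); rewrite !val_sl2mx // => /mx22_inj. Qed.

Lemma sl2_eta s : exists a b c d, s = sl2mx a b c d /\ a * d - b * c = 1.
Proof.
set A := val s; exists (A 0 0), (A 0 1), (A 1 0), (A 1 1).
have h : A 0 0 * A 1 1 - A 0 1 * A 1 0 = 1.
  by rewrite -det_mx22 -mx22_eta; apply/eqP/(valP s).
by split=> //; apply: val_inj; rewrite val_sl2mx // -mx22_eta.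
Qed.

Lemma sl2mxM a b c d a' b' c' d' :
    a * d - b * c = 1 -> a' * d' - b' * c' = 1 ->
  (sl2mx a b c d * sl2mx a' b' c' d')%g =
  sl2mx (a * a' + b * c') (a * b' + b * d') (c * a' + d * c') (c * b' + d * d').
Proof.
move=> h h'; apply: val_inj; rewrite val_mul !val_sl2mx ?mul_mx22 //.
transitivity ((a * d - b * c) * (a' * d' - b' * c')); first by ring.
by rewrite h h' mulr1.
Qed.

Lemma sl2mxV a b c d : a * d - b * c = 1 -> (sl2mx a b c d)^-1%g = sl2mx d (- b) (- c) a.
Proof.
move=> h; have h' : d * a - - b * - c = 1 by rewrite -h; ring.
apply/esym/(mulgI (sl2mx a b c d)); rewrite mulgV sl2mxM //.
apply: val_inj; rewrite val_sl2mx; last by rewrite -(mulr1 1) -{1}h -h'; ring.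
apply: esym; transitivity (1%:M : 'M[F]_2); first by [].
rewrite [LHS]mx22_eta !mxE /=.
by congr mx22; rewrite -?h; ring.
Qed.

Definition sl2tr s : F := \tr (val s).

Lemma sl2tr_mx a b c d : a * d - b * c = 1 -> sl2tr (sl2mx a b c d) = a + d.
Proof. by move=> h; rewrite /sl2tr val_sl2mx // tr_mx22. Qed.

Lemma sl2trJ s x : sl2tr (s ^ x)%g = sl2tr s.
Proof.
rewrite /sl2tr /conjg val_mul mxtrace_mulC -val_mul.
by rewrite mulgK.
Qed.

Definition companion r : sl2 F := sl2mx 0 (-1) 1 r.

Lemma det_companion r : 0 * r - (-1) * 1 = 1. Proof. by ring. Qed.

(* If the columns of [x] are [w] and [s w], then [s x = x companion]; the determinant
   of such an [x] is a quadratic form in [w] of discriminant [tr(s)^2 - 4]. *)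
Lemma card_conj_companion s : sl2tr s ^+ 2 != 4 ->
  (#|F| - 2 <= #|[set x | (s ^ x == companion (sl2tr s))%g]|)%N.
Proof.
have [a [b [c [d [-> h]]]]] := sl2_eta s; rewrite sl2tr_mx // => D0.
have D1 : (d - a) ^+ 2 - 4 * c * (- b) != 0.
  rewrite (_ : _ - _ = (a + d) ^+ 2 - 4 * (a * d - b * c)); last by ring.
  by rewrite h mulr1 subr_eq0.
apply: leq_trans (card_conic D1 (oner_neq0 _)) _.
pose f (w : F * F) := sl2mx w.1 (a * w.1 + b * w.2) w.2 (c * w.1 + d * w.2).
set S := [set p : F * F | _].
have Sdet w : w \in S ->
    w.1 * (c * w.1 + d * w.2) - (a * w.1 + b * w.2) * w.2 = 1.
  by rewrite inE => /eqP <-; ring.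
rewrite -(@card_in_imset _ _ f S); last first.
  by move=> [u v] [u' v'] /Sdet h1 /Sdet h2 /(sl2mx_inj h1 h2) [/= -> _ -> _].
apply/subset_leq_card/subsetP => _ /imsetP [[u v] /Sdet /= h1 ->]; rewrite inE.
have -> : (sl2mx a b c d ^ f (u, v) == companion (a + d))%g =
          (sl2mx a b c d * f (u, v) == f (u, v) * companion (a + d))%g.
  by rewrite conjgE -(can_eq (mulKg (f (u, v)))) !mulgA mulgV mul1g.
rewrite /f /companion !sl2mxM ?det_companion //=; apply/eqP.
congr sl2mx; try by ring.
  transitivity ((a + d) * (a * u + b * v) - (a * d - b * c) * u); first by ring.
  by rewrite h; ring.
transitivity ((a + d) * (c * u + d * v) - (a * d - b * c) * v); first by ring.
by rewrite h; ring.
Qed.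

(** Both elements are conjugate to the same companion matrix; a fixed [y] taking [t] there turns the
    conjugators of [s] to it into conjugators of [s] to [t]. *)
Lemma card_conj_sl2 s t : sl2tr s = sl2tr t -> sl2tr s ^+ 2 != 4 ->
  (#|F| - 2 <= #|[set x | (s ^ x == t)%g]|)%N.
Proof.
(* For q = 2 the bound is zero; otherwise the count is positive and provides [y]. *)
move=> st s0; have [->//|] := posnP (#|F| - 2).
move=> q0; have := s0; rewrite {1}st => /card_conj_companion.
move=> /(leq_trans q0) /card_gt0P [y]; rewrite inE => /eqP ty.
apply: leq_trans (card_conj_companion s0) _.
rewrite -(card_imset _ (mulIg y^-1)%g); apply/subset_leq_card/subsetP.
move=> _ /imsetP [x sx ->]; move: sx; rewrite !inE => /eqP sx.
by rewrite conjgM sx st -ty conjgK.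
Qed.

(** If the upper right entry is nonzero, the first row and the trace determine the matrix. If it is
    zero, the upper left entry is one of at most two roots of X^2 - r X + 1 and the lower left one
    is free. *)
Lemma card_sl2tr_eq r : (#|[set s | sl2tr s == r]| <= #|F| ^ 2 + 2 * #|F|)%N.
Proof.
pose U := [set s : sl2 F | val s 0 1 == 0].
have entry a b c d : a * d - b * c = 1 ->
  [/\ val (sl2mx a b c d) 0 0 = a, val (sl2mx a b c d) 0 1 = b
    & val (sl2mx a b c d) 1 0 = c].
  by move=> h; rewrite val_sl2mx // !mxE.
rewrite -[X in (X <= _)%N](cardsID U) addnC leq_add //.
  rewrite -mulnn -card_prod.
  rewrite -(@card_in_imset _ _ (fun s : sl2 F => (val s 0 0, val s 0 1))) ?max_card //.
  move=> s t; have [a [b [c [d [-> h]]]]] := sl2_eta s.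
  have [a' [b' [c' [d' [-> h']]]]] := sl2_eta t.
  rewrite !inE !sl2tr_mx //; have [-> -> _] := entry _ _ _ _ h.
  have [-> -> _] := entry _ _ _ _ h'.
  move=> /andP [b0 /eqP tr] /andP [_ /eqP tr'] [ea eb]; subst a' b'.
  have ed : d = d' by apply: (addrI a); rewrite tr tr'.
  subst d'; congr sl2mx; apply: (mulfI b0).
  transitivity (a * d - (a * d - b * c)); first by ring.
  by rewrite h -h'; ring.
pose Z := [set x | 1 * x ^+ 2 + (- r) * x + 1 == 0].
apply: (@leq_trans (#|Z| * #|F|)); last first.
  by rewrite leq_mul2r card_quadratic_roots ?oner_neq0 ?orbT.
rewrite -cardsT -cardsX.
rewrite -(@card_in_imset _ _ (fun s : sl2 F => (val s 0 0, val s 1 0))); last first.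
  move=> s t; have [a [b [c [d [-> h]]]]] := sl2_eta s.
  have [a' [b' [c' [d' [-> h']]]]] := sl2_eta t.
  rewrite !inE !sl2tr_mx //; have [-> -> ->] := entry _ _ _ _ h.
  have [-> -> ->] := entry _ _ _ _ h'.
  move=> /andP [/eqP tr /eqP b0] /andP [/eqP tr' /eqP b0'] [ea eb]; subst.
  by congr sl2mx; apply: (addrI a'); rewrite tr'.
apply/subset_leq_card/subsetP => _ /imsetP [s sU ->]; move: sU.
have [a [b [c [d [-> h]]]]] := sl2_eta s.
rewrite !inE !sl2tr_mx //; have [-> -> ->] := entry _ _ _ _ h.
move=> /andP [/eqP <- /eqP b0]; rewrite andbT; apply/eqP => /=.
transitivity (1 - (a * d - b * c)); first by rewrite b0; ring.
by rewrite h subrr.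
Qed.

Lemma card_sl2_le : (#|{: sl2 F}| <= #|F| ^ 3 + 2 * #|F| ^ 2)%N.
Proof.
rewrite -sum1_card (partition_big sl2tr xpredT) //=.
apply: (@leq_trans (\sum_(r : F) (#|F| ^ 2 + 2 * #|F|))).
  apply: leq_sum => r _; rewrite sum1dep_card; exact: card_sl2tr_eq.
by rewrite sum_nat_const mulnDr -expnS mulnCA.
Qed.

(** Count only the matrices with nonzero upper left entry. *)
Lemma card_sl2_ge : (#|F| ^ 2 * (#|F| - 1) <= #|{: sl2 F}|)%N.
Proof.
pose f (p : F * F * F) := sl2mx p.2 p.1.1 p.1.2 ((1 + p.1.1 * p.1.2) / p.2).
pose S := setX [set: F * F] [set~ (0 : F)].
have <- : #|S| = (#|F| ^ 2 * (#|F| - 1))%N.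
  by rewrite cardsX cardsT card_prod mulnn cardsC1 subn1.
rewrite -(@card_in_imset _ _ f S) ?max_card //.
have fdet p : p \in S -> p.2 * ((1 + p.1.1 * p.1.2) / p.2) - p.1.1 * p.1.2 = 1.
  by rewrite !inE /= => p0; field.
move=> [[b c] a] [[b' c'] a'] h h' /sl2mx_inj.
by move=> /(_ (fdet _ h) (fdet _ h')) [/= -> -> -> _].
Qed.

(* [fricke (tr x) (tr y) (tr (x * y)) + 2] is the trace of the commutator of [x] and [y]. *)
Definition fricke a b c := c ^+ 2 - a * b * c + a ^+ 2 + b ^+ 2 - 4.

(** With first column (X, Z), the two traces fix the other entries, and the determinant condition is
    X^2 + r X Z + Z^2 - a X - b Z + 1 = 0. Its centre is ([x0], [z0]); after recentring, the
    constant [e] is [fricke a b r] / (4 - r^2). *)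
Lemma card_trace_pair_companion a b r : r ^+ 2 != 4 -> fricke a b r != 0 ->
  (#|F| - 2 <= #|[set x | (sl2tr x == a) && (sl2tr (x^-1 * companion r)%g == b)]|)%N.
Proof.
move=> r4 fr; have D0 : 4 - r ^+ 2 != 0 by rewrite subr_eq0 eq_sym.
pose x0 := (2 * a - r * b) / (4 - r ^+ 2).
pose z0 := (2 * b - r * a) / (4 - r ^+ 2).
pose e := x0 ^+ 2 + r * x0 * z0 + z0 ^+ 2 - 1.
have e0 : e != 0.
  rewrite (_ : e = fricke a b r / (4 - r ^+ 2)).
    by rewrite mulf_neq0 ?invr_eq0.
  by rewrite /e /x0 /z0 /fricke; field.
have D1 : r ^+ 2 - 4 * 1 * 1 != 0 by rewrite !mulr1 subr_eq0.
apply: leq_trans (card_conic D1 e0) _.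
set S := [set p : F * F | _].
pose y (p : F * F) := (z0 + p.2) + (x0 + p.1) * r - b.
pose f p := sl2mx (x0 + p.1) (y p) (z0 + p.2) (a - (x0 + p.1)).
have fdet p : p \in S -> (x0 + p.1) * (a - (x0 + p.1)) - y p * (z0 + p.2) = 1.
  case: p => u v; rewrite inE /= => /eqP uv; apply: (@addIr _ (- 1)); rewrite subrr.
  transitivity (e - (1 * u ^+ 2 + r * u * v + 1 * v ^+ 2)); last by rewrite uv subrr.
  by rewrite /e /y /x0 /z0 /=; field.
rewrite -(@card_in_imset _ _ f S); last first.
  move=> [u v] [u' v'] /fdet h1 /fdet h2 /(sl2mx_inj h1 h2) [/= eu _ ev _].
  by rewrite (addrI _ eu) (addrI _ ev).
apply/subset_leq_card/subsetP => _ /imsetP [p /fdet h ->]; rewrite inE /f.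
have h' : (a - (x0 + p.1)) * (x0 + p.1) - - y p * - (z0 + p.2) = 1 by rewrite -h; ring.
rewrite sl2tr_mx // sl2mxV // sl2mxM ?det_companion // sl2tr_mx.
  by apply/andP; split; apply/eqP; rewrite /y; ring.
rewrite -[RHS](mulr1 1) -[X in _ = X * _]h' -[X in _ = _ * X](det_companion r); ring.
Qed.

Lemma card_trace_pair a b z : sl2tr z ^+ 2 != 4 -> fricke a b (sl2tr z) != 0 ->
  (#|F| - 2 <= #|[set x | (sl2tr x == a) && (sl2tr (x^-1 * z)%g == b)]|)%N.
Proof.
move=> z4 fr; have [->//|] := posnP (#|F| - 2).
move=> /leq_trans/(_ (card_conj_companion z4))/card_gt0P [y]; rewrite inE => /eqP zy.
apply: leq_trans (card_trace_pair_companion z4 fr) _.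
rewrite -(card_imset _ (conjg_inj y^-1)%g); apply/subset_leq_card/subsetP.
move=> _ /imsetP [x xP ->]; move: xP; rewrite !inE => /andP [xa xb].
by rewrite sl2trJ xa -(sl2trJ _ y) conjMg conjVg conjgKV zy.
Qed.

(** There are at least q - 2 choices of w = s ^ x with w^-1 z of the trace of [t], then at least q -
    2 conjugators for each of the two factors. *)
Lemma num_conj_factor_ge s t z :
    sl2tr s ^+ 2 != 4 -> sl2tr t ^+ 2 != 4 -> sl2tr z ^+ 2 != 4 ->
    fricke (sl2tr s) (sl2tr t) (sl2tr z) != 0 ->
  ((#|F| - 2) ^ 3 <= num_conj_factor s t z)%N.
Proof.
move=> s4 t4 z4 fr; rewrite /num_conj_factor -sum1_card.
rewrite (partition_big (fun p : sl2 F * sl2 F => s ^ p.1)%g xpredT) //=.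
set A := [set x | (sl2tr x == sl2tr s) && (sl2tr (x^-1 * z)%g == sl2tr t)].
have hA : (#|F| - 2 <= #|A|)%N by exact: card_trace_pair.
apply: leq_trans (_ : \sum_(w in A) (#|F| - 2) ^ 2 <= _)%N.
  by rewrite sum_nat_const expnS leq_mul2r hA orbT.
rewrite [X in (_ <= X)%N](bigID [in A]) /=; apply: leq_trans (leq_addr _ _).
apply: leq_sum => w; rewrite inE => /andP [/eqP ws /eqP wt].
rewrite sum1dep_card -mulnn.
apply: (@leq_trans #|setX [set x | s ^ x == w]%g [set y | t ^ y == w^-1 * z]%g|).
  by rewrite cardsX leq_mul ?card_conj_sl2 // ?ws ?wt.
apply/subset_leq_card/subsetP => -[x y]; rewrite !inE /= => /andP [/eqP -> /eqP ->].
by rewrite mulKVg !eqxx.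
Qed.

(** * Exceptional traces and the total deficit *)

Lemma card_sq_eq4 : (#|[set r : F | (r ^+ 2 == 4)%R]| <= 2)%N.
Proof.
apply: leq_trans (card_quadratic_roots 0 (- 4) (oner_neq0 F)).
by apply/subset_leq_card/subsetP => r; rewrite !inE mul1r mul0r addr0 subr_eq0.
Qed.

Lemma card_fricke_eq0 a b : (#|[set r : F | (fricke a b r == 0)%R]| <= 2)%N.
Proof.
apply: leq_trans (card_quadratic_roots (- (a * b)) (a ^+ 2 + b ^+ 2 - 4) (oner_neq0 F)).
apply/subset_leq_card/subsetP => r; rewrite !inE => /eqP e; apply/eqP.
by rewrite -[RHS]e /fricke; ring.
Qed.

Lemma card_field_ge2 : (2 <= #|F|)%N.
Proof.
apply: leq_trans (max_card [set (0 : F); 1]).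
by rewrite cards2 eq_sym oner_eq0.
Qed.

Lemma card_sl2tr_in (Z : {set F}) k : (#|Z| <= k)%N ->
  (#|[set s : sl2 F | sl2tr s \in Z]| <= k * (2 * #|F| ^ 2))%N.
Proof.
move=> hZ; rewrite -sum1_card (partition_big sl2tr [in Z]) /=; last first.
  by move=> s; rewrite inE.
apply: (@leq_trans (\sum_(r in Z) (2 * #|F| ^ 2))); last first.
  by rewrite sum_nat_const leq_mul2r hZ orbT.
apply: leq_sum => r rZ; rewrite sum1dep_card.
apply: leq_trans (_ : #|[set s : sl2 F | sl2tr s == r]| <= _)%N.
  by apply/subset_leq_card/subsetP => s; rewrite !inE => /andP [].
apply: leq_trans (card_sl2tr_eq r) _.
by rewrite [leqRHS]mul2n -addnn leq_add2l -mulnn leq_mul2r card_field_ge2 orbT.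
Qed.

(** At most four traces of [z] are exceptional, each taken by at most 2 q^2 elements, whose
    shortfall is at most N; any other [z] falls short by at most 8 q^2. *)
Lemma deficit_sl2_le s t : sl2tr s ^+ 2 != 4 -> sl2tr t ^+ 2 != 4 ->
  (deficit s t <= 16 * #|F| ^ 2 * #|{: sl2 F}|)%N.
Proof.
move=> s4 t4; pose Z := [set r : F | r ^+ 2 == 4] :|: [set r | fricke (sl2tr s) (sl2tr t) r == 0].
have cZ : (#|Z| <= 4)%N.
  apply: leq_trans (leq_card_setU _ _) _.
  exact: (leq_add card_sq_eq4 (card_fricke_eq0 _ _)).
set N := #|{: sl2 F}|; set q := #|F|.
have hN : (N - (q - 2) ^ 3 <= 8 * q ^ 2)%N.
  have := card_sl2_le; have := card_field_ge2; rewrite -/N -/q.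
  case: q => [|[|k]] //; rewrite !subSS subn0 => _; nia.
apply: (@leq_trans (\sum_(z : sl2 F) (8 * q ^ 2 + (sl2tr z \in Z) * N))).
  apply: leq_sum => z _; case: (boolP (sl2tr z \in Z)) => zZ.
    by rewrite mul1n; apply: leq_trans (leq_subr _ _) _; rewrite leq_addl.
  rewrite mul0n addn0; apply: leq_trans hN; apply: leq_sub2l.
  by move: zZ; rewrite !inE negb_or => /andP [z4 zf]; apply: num_conj_factor_ge.
rewrite big_split /= sum_nat_const -big_distrl /= -big_mkcond sum1dep_card.
apply: (@leq_trans (N * (8 * q ^ 2) + 4 * (2 * q ^ 2) * N)).
  by rewrite leq_add2l leq_mul2r card_sl2tr_in ?orbT.
by rewrite mulnC -mulnDl mulnA -mulnDl.
Qed.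

(** At most 4 q^2 elements have squared trace 4. Pairs containing one get the trivial bound N^2 and
    cost 8 q^2 N^3 in all; the rest cost 16 q^2 N^3. *)
Lemma sum_deficit_sl2_le :
  (\sum_(s : sl2 F) \sum_(t : sl2 F) deficit s t
     <= 24 * #|F| ^ 2 * #|{: sl2 F}| ^ 3)%N.
Proof.
set N := #|{: sl2 F}|; set q := #|F|; pose Z := [set r : F | r ^+ 2 == 4].
have cZ : (\sum_(s : sl2 F) (sl2tr s \in Z) <= 4 * q ^ 2)%N.
  rewrite -big_mkcond sum1dep_card (leq_trans (card_sl2tr_in card_sq_eq4)) //.
  by rewrite mulnA.
pose e (s : sl2 F) := nat_of_bool (sl2tr s \in Z).
apply: (@leq_trans (\sum_(s : sl2 F) \sum_(t : sl2 F)
                      (16 * q ^ 2 * N + (e s + e t) * N ^ 2))).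
  apply: leq_sum => s _; apply: leq_sum => t _; rewrite /e.
  have := deficit_le s t; rewrite -/N => le.
  case: (boolP (sl2tr s \in Z)) => sZ.
    by rewrite mulnDl mul1n addnCA (leq_trans le) ?leq_addr.
  case: (boolP (sl2tr t \in Z)) => tZ.
    by rewrite mul1n (leq_trans le) ?leq_addl.
  by rewrite addn0; apply: deficit_sl2_le; move: sZ tZ; rewrite !inE.
have -> : (\sum_(s : sl2 F) \sum_(t : sl2 F) (16 * q ^ 2 * N + (e s + e t) * N ^ 2)
   = 16 * q ^ 2 * N ^ 3 + 2 * (\sum_(s : sl2 F) e s) * N ^ 3)%N.
  under eq_bigr => s _ do
    rewrite big_split sum_nat_const -big_distrl big_split /= sum_nat_const -/N.
  rewrite big_split sum_nat_const -big_distrl big_split /= sum_nat_const -/N.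
  rewrite -big_distrr /= -/N; set E := (\sum_i e i)%N.
  by ring.
rewrite -mulnDl leq_mul2r; apply/orP; right.
apply: (@leq_trans (16 * q ^ 2 + 2 * (4 * q ^ 2))); last by lia.
by rewrite leq_add2l leq_mul2l; exact: cZ.
Qed.

(** Cubing turns q^2 into (q^3)^2 <= (2 N)^2. The constant is rounded up to a twelfth power, as a
    twelfth root is taken later. *)
Lemma sum_deficit_sl2_cube_le :
  ((2 * \sum_(s : sl2 F) \sum_(t : sl2 F) deficit s t) ^ 3
     <= 4 ^ 12 * #|{: sl2 F}| ^ 11)%N.
Proof.
have := sum_deficit_sl2_le; set D := (\sum_s _)%N.
set N := #|{: sl2 F}|; set q := #|F| => hD.
have hN : (q ^ 3 <= 2 * N)%N.
  have := card_sl2_ge; rewrite -/N -/q => /(leq_mul (leqnn 2)); apply: leq_trans.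
  rewrite mulnCA expnSr leq_mul2l mulnBr muln1.
  by have := card_field_ge2; rewrite -/q => ?; apply/orP; right; lia.
have numE k : ((k * q ^ 2 * N ^ 3) ^ 3 = k ^ 3 * (q ^ 3) ^ 2 * N ^ 9)%N by ring.
have NE k l : (k ^ 3 * (l * N) ^ 2 * N ^ 9 = k ^ 3 * l ^ 2 * N ^ 11)%N by ring.
apply: (@leq_trans ((2 ^ 6 * q ^ 2 * N ^ 3) ^ 3)).
  rewrite leq_exp2r //; apply: (@leq_trans (2 * (24 * q ^ 2 * N ^ 3))).
    by rewrite leq_mul2l hD orbT.
  by rewrite !mulnA !leq_mul2r !orbT.
rewrite numE; apply: (@leq_trans ((2 ^ 6) ^ 3 * (2 * N) ^ 2 * N ^ 9)).
  by rewrite leq_mul2r leq_mul2l leq_exp2r // hN !orbT.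
by rewrite NE leq_mul2r -(expnM 2 2) -(expnM 2 6) -expnD leq_exp2l // orbT.
Qed.

End SL2Counting.

(* From [p ^ 12 * N = 1] one reads [p = N ^ (-1/12)]. *)
Lemma twelfth_root_bound (R : realFieldType) (X D N U V p : R) :
    0 <= D -> 0 <= N -> 0 <= U -> 0 <= V -> 0 <= p -> p ^+ 12 * N = 1 ->
    X ^+ 4 <= D * (U ^+ 2) ^+ 2 * (V ^+ 2) ^+ 2 ->
    D ^+ 3 <= 4 ^+ 12 * N ^+ 11 ->
  `|X| <= 4 * p * N * U * V.
Proof.
move=> D0 N0 U0 V0 p0 pN hX hD.
rewrite -(@ler_pXn2r _ 12) ?nnegrE ?normr_ge0 ?mulr_ge0 //.
apply: (@le_trans _ _ (D ^+ 3 * U ^+ 12 * V ^+ 12)).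
  rewrite (_ : D ^+ 3 * U ^+ 12 * V ^+ 12 = (D * (U ^+ 2) ^+ 2 * (V ^+ 2) ^+ 2) ^+ 3).
    rewrite (exprM _ 4 3) -normrX ger0_norm ?exprn_even_ge0 //.
    apply: lerXn2r hX; rewrite nnegrE ?exprn_even_ge0 //.
    by rewrite !mulr_ge0 ?exprn_ge0.
  by ring.
have -> : (4 * p * N * U * V) ^+ 12
          = 4 ^+ 12 * N ^+ 11 * (p ^+ 12 * N) * U ^+ 12 * V ^+ 12 by ring.
by rewrite pN mulr1 !ler_wpM2r ?exprn_ge0.
Qed.

(** * Transfer to the concrete reals *)

From Stdlib Require Import Reals.
From mathcomp Require Import Rstruct.

Section Transfer.
Variable F : finFieldType.

Definition val2 (p : sl2 F * sl2 F) : 'M[F]_2 * 'M[F]_2 := (val p.1, val p.2).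

(** Carries sums over matrix pairs to the group type; the default of [insubd] is never reached on
    [SL2sq F]. *)
Lemma Rsum_SL2sq (f : 'M[F]_2 * 'M[F]_2 -> R) :
  Rsum (SL2sq F) f = \sum_(p : sl2 F * sl2 F) f (val2 p).
Proof.
rewrite /Rsum; change (\sum_(x in SL2sq F) f x = \sum_p f (val2 p)).
rewrite (reindex_onto val2 (fun x => (insubd (sl2_one F) x.1, insubd (sl2_one F) x.2))) /=.
  apply: eq_bigl => -[s t]; rewrite /= !valKd eqxx andbT !inE /=.
  by rewrite (valP s) (valP t).
move=> [A B]; rewrite !inE /val2 /= => /andP [hA hB].
by rewrite !insubdK // unfold_in.
Qed.

Lemma card_SL2 : #|SL2 F| = #|{: sl2 F}|.
Proof. by rewrite card_sig cardsE; apply: eq_card => A. Qed.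

Lemma prob_wordE (u v : 'M[F]_2 * 'M[F]_2 -> R) (g : sl2 F) :
  prob_word u v (val g) =
  \sum_(a : sl2 F * sl2 F) \sum_(b : sl2 F * sl2 F)
    if (a.1 * b.1 * a.2 * b.2 == g)%g then (u \o val2) a * (v \o val2) b else 0.
Proof. by rewrite /prob_word Rsum_SL2sq; apply: eq_bigr => a _; rewrite Rsum_SL2sq. Qed.

Lemma l2norm_ge0 (u : 'M[F]_2 * 'M[F]_2 -> R) : 0 <= l2norm u.
Proof. by apply/RleP; exact: sqrt_pos. Qed.

Lemma sqr_l2norm (u : 'M[F]_2 * 'M[F]_2 -> R) :
  l2norm u ^+ 2 = \sum_a (u \o val2) a ^+ 2.
Proof.
rewrite /l2norm Rsum_SL2sq RsqrtE sqr_sqrtr //.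
by apply: sumr_ge0 => a _; exact: sqr_ge0.
Qed.

End Transfer.

Theorem mainTheorem3 :
  exists C c : R, (0 < C)%R /\ (0 < c)%R /\
    forall (F : finFieldType) (u v : 'M[F]_2 * 'M[F]_2 -> R),
      is_distr u -> is_distr v ->
      forall g : 'M[F]_2, g \in SL2 F ->
        (Rabs (prob_word u v g - / INR #|SL2 F|)
         <= (C * Rpower (INR #|SL2 F|) (- c)) * INR #|SL2 F|
            * l2norm u * l2norm v)%R.
Proof.
(* The deviation is at most the fourth root of 2 D times the norms, and 2 D <= 4^4 N^(11/3) gives 4
   N^(11/12) = 4 N^(-1/12) N. *)
exists 4%:R, 12%:R^-1; split; first by apply/RltP; rewrite ltr0n.
split; first by apply/RltP; rewrite invr_gt0 ltr0n.
move=> F u v [_ [_ u1]] [_ [_ v1]] g; rewrite inE => gdet.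
rewrite -[g](@insubdK _ _ (sl2 F) (sl2_one F)) //; set G := insubd _ _.
rewrite card_SL2 prob_wordE; rewrite !Rsum_SL2sq in u1 v1.
have N0 : (0 < #|{: sl2 F}|)%nat by apply/card_gt0P; exists (sl2_one F).
rewrite INRE RabsE; apply/RleP.
have hX := interleaved_product_deviation G u1 v1.
set D := (\sum_s \sum_t deficit s t)%N in hX.
set X := _ - _ in hX; set N := #|{: sl2 F}|.
pose p := Rpower N%:R (Ropp 12%:R^-1).
have p0 : 0 <= p by apply/ltW/RltP; exact: exp_pos.
have pN : p ^+ 12 * N%:R = 1.
  rewrite -RpowE -Rpower_pow; last by exact: exp_pos.
  have e1 : Rmult (Ropp 12%:R^-1) (INR 12) = Ropp 1.
    by rewrite INRE RmultE RoppE mulNr mulVf ?pnatr_eq0.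
  rewrite Rpower_mult e1.
  have NR : Rlt 0 N%:R by apply/RltP; rewrite ltr0n.
  by rewrite Rpower_Ropp Rpower_1 // RinvE mulVf // pnatr_eq0 -lt0n.
apply: (@twelfth_root_bound R X (D%:R *+ 2) N%:R _ _ p) => //.
all: rewrite ?l2norm_ge0 //.
- by rewrite mulrn_wge0.
- by rewrite !sqr_l2norm.
- rewrite -mulr_natl -natrM -!natrX -natrM ler_nat; exact: sum_deficit_sl2_cube_le.
Qed.
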